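(* Let $\mathcal E$ be a Hilbert space and $\theta\in B(\mathcal E,F^2(H_n)\otimes\mathcal E)$ nonzero, written $\theta h=\sum_{\alpha\in\mathbb F_n^+}e_{\tilde\alpha}\otimes\theta_\alpha h$ with $\theta_\alpha\in B(\mathcal E)$; let $k$ be the smallest integer $\ge0$ such that $\theta_{\alpha_0}\ne0$ for some $\alpha_0$ with $|\alpha_0|=k$. (i) If $\dim\mathcal E<\infty$, then $\Delta_{K_\theta}\ne0$, $$\langle\Delta_{K_\theta}h,h\rangle\ge\sum_{|\alpha|=k}\langle\theta_\alpha^*\theta_\alpha h,h\rangle\quad(h\in\mathcal E),$$ and $e(K_\theta)\ge\ln\det\big[\sum_{|\alpha|=k}\theta_\alpha^*\theta_\alpha\big]$. (ii) If $\mathcal E$ is arbitrary and $\theta$ is the symbol of a nonzero multi-analytic operator $M_\theta\in R_n^\infty\bar\otimes B(\mathcal E)$, then the same operator inequality holds, and if moreover $\dim\mathcal E<\infty$, so does the entropy inequality. In particular, if $\theta\in F^2(H_n)$ is nonzero (case $\mathcal E=\mathbb C$), then $e(K_\theta)>-\infty$ and $e(K_\theta)\ge\ln|\theta(0)|^2$, where $\theta(0)=\theta_{g_0}$.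
   Context: $\mathbb F_n^+$ is the free semigroup on $g_1,\dots,g_n$ with identity $g_0$, $|\alpha|$ is word length, $\tilde\alpha$ is the reversed word ($\widetilde{g_{i_1}\cdots g_{i_k}}=g_{i_k}\cdots g_{i_1}$). $F^2(H_n)$ is the full Fock space with basis $e_\alpha$, $S_i\psi=e_i\otimes\psi$, $S_\alpha$ products. For $\theta\in B(\mathcal E,F^2(H_n)\otimes\mathcal E)$, $K_\theta:\mathbb F_n^+\times\mathbb F_n^+\to B(\mathcal E)$ is defined by $\langle K_\theta(\sigma,\omega)h,h'\rangle=\langle(S_\omega\otimes I)\theta h,(S_\sigma\otimes I)\theta h'\rangle$. For a positive definite kernel $K$ with values in $B(\mathcal E)$, $\Delta_K\in B(\mathcal E)$ is defined by $\langle\Delta_Kh,h\rangle=\inf\sum_{\sigma,\omega}\langle K(\omega,\sigma)h_\sigma,h_\omega\rangle$, the infimum over finitely supported families $\{h_\sigma\}\subset\mathcal E$ with $h_{g_0}=h$; for $\dim\mathcal E<\infty$, $e(K)=\ln\det\Delta_K$ (with $\ln0=-\infty$). $R_n^\infty\bar\otimes B(\mathcal E)$ is the set of bounded $M$ on $F^2(H_n)\otimes\mathcal E$ with $M(S_i\otimes I)=(S_i\otimes I)M$; its symbol is $h\mapsto M(1\otimes h)$. *)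

(* Defs.v *)
From HB Require Import structures.
From mathcomp Require Import all_boot all_order all_algebra.
From mathcomp Require Import complex.
From mathcomp Require Import all_classical all_reals.
From mathcomp Require Import topology normedtype sequences exp.
Set Implicit Arguments. Unset Strict Implicit. Unset Printing Implicit Defensive.
Import Order.TTheory GRing.Theory Num.Theory.
Local Open Scope ring_scope.
Local Open Scope complex_scope.

Section Defs.
Variable R : realType.
Local Notation C := R[i].

(* Words of the free semigroup F_n^+ on g_1..g_n : sequences of letters
   in 'I_n; the identity g_0 is the empty word [::]; |w| = size w;
   the reversed word is rev w. *)

(* Finite sum over all words of length exactly j. *)
Definition wsum_eq {V : nmodType} (n j : nat) (f : seq 'I_n -> V) : V :=
  \sum_(t : j.-tuple 'I_n) f (tval t).

(* Finite sum over all words of length < N. *)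
Definition wsum_lt {V : nmodType} (n N : nat) (f : seq 'I_n -> V) : V :=
  \sum_(j < N) wsum_eq j f.

(* Infinite sum over all words of a complex family (used only for absolutely
   summable families): limit of the partial sums over words of length < N,
   taken on real and imaginary parts. *)
Definition csum (n : nat) (f : seq 'I_n -> C) : C :=
  Complex (limn (fun N : nat => (complex.Re (wsum_lt N f) : R^o)))
          (limn (fun N : nat => (complex.Im (wsum_lt N f) : R^o))).

Section Hilbert.
Variable E : lmodType C.
Variable ip : E -> E -> C.   (* inner product, linear in the first variable *)

Definition nrm2 (x : E) : R := complex.Re (ip x x).

(* (E, ip) is a complex Hilbert space. *)
Definition hilbert_space : Prop :=
  [/\ (forall (a : C) (x y z : E), ip (a *: x + y) z = a * ip x z + ip y z),
      (forall x y : E, ip y x = (ip x y)^*),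
      (forall x : E, 0 <= ip x x),
      (forall x : E, ip x x = 0 -> x = 0) &
      (* completeness *)
      (forall u : nat -> E,
         (forall e : R, 0 < e -> exists N, forall p q, (N <= p)%N -> (N <= q)%N ->
             nrm2 (u p - u q) < e) ->
         exists x : E, forall e : R, 0 < e -> exists N, forall p, (N <= p)%N ->
             nrm2 (u p - x) < e)].

(* b is an orthonormal basis of E with m elements (so dim E = m < oo). *)
Definition onb (m : nat) (b : 'I_m -> E) : Prop :=
  (forall i j, ip (b i) (b j) = (i == j)%:R) /\
  (forall x : E, x = \sum_i ip x (b i) *: b i).

Variable n : nat.

(* theta : the coefficients theta_alpha in B(E) of
   theta h = sum_alpha e_{rev alpha} (x) theta_alpha h. *)
Variable theta : seq 'I_n -> E -> E.

(* theta in B(E, F^2(H_n) (x) E), with F^2(H_n) (x) E identified with the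
   E-valued square-summable families indexed by words. *)
Definition symbol_bounded : Prop :=
  (forall alpha (a : C) (x y : E),
      theta alpha (a *: x + y) = a *: theta alpha x + theta alpha y) /\
  exists c : R, forall (h : E) (N : nat),
      wsum_lt N (fun alpha => nrm2 (theta alpha h)) <= c * nrm2 h.

(* (S_omega (x) I) theta h, as an E-valued family indexed by words gamma:
   its gamma-coefficient is theta_alpha h if gamma = omega rev(alpha), else 0. *)
Definition Stheta (omega : seq 'I_n) (h : E) (gamma : seq 'I_n) : E :=
  if take (size omega) gamma == omega
  then theta (rev (drop (size omega) gamma)) h else 0.

(* <K_theta(sigma, omega) h, h'> = <(S_omega (x) I) theta h, (S_sigma (x) I) theta h'> *)
Definition Ktheta (sigma omega : seq 'I_n) (h h' : E) : C :=
  csum (fun gamma => ip (Stheta omega h gamma) (Stheta sigma h' gamma)).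

(* <Delta_K h, h> = inf sum_{sigma,omega} <K(omega,sigma) h_sigma, h_omega>
   over finitely supported families with h_{g_0} = h. *)
Definition DeltaQ (h : E) : R :=
  inf [set x : R | exists (N : nat) (hs : seq 'I_n -> E),
        [/\ hs [::] = h, (forall w, (N <= size w)%N -> hs w = 0) &
            x = complex.Re (wsum_lt N (fun sigma => wsum_lt N (fun omega =>
                   Ktheta omega sigma (hs sigma) (hs omega))))]].

(* Matrix of Delta_K in the basis b: entry (i,j) is <Delta_K b_j, b_i>,
   recovered from the quadratic form by polarization. *)
Definition DeltaMx (m : nat) (b : 'I_m -> E) : 'M[C]_m :=
  \matrix_(i, j) ((4%:R)^-1 * \sum_(l < 4)
       'i ^+ l * (DeltaQ (b j + 'i ^+ l *: b i))%:C).

(* Matrix of sum_{|alpha| = k} theta_alpha^* theta_alpha in the basis b. *)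
Definition leadMx (k m : nat) (b : 'I_m -> E) : 'M[C]_m :=
  \matrix_(i, j) wsum_eq k (fun alpha => ip (theta alpha (b j)) (theta alpha (b i))).

End Hilbert.

(* ln with ln 0 = -oo (applied to determinants of positive matrices). *)
Definition lnE (x : R) : \bar R := if x <= 0 then -oo%E else (ln x)%:E.

(* e(K_theta) = ln det Delta_K, computed in an orthonormal basis b. *)
Definition entropy (E : lmodType C) (ip : E -> E -> C) (n : nat)
  (theta : seq 'I_n -> E -> E) (m : nat) (b : 'I_m -> E) : \bar R :=
  lnE (complex.Re (\det (DeltaMx ip theta b))).

(* ---- Multi-analytic operators ---- *)
Section MultiAnalytic.
Variable E : lmodType C.
Variable ip : E -> E -> C.
Variable n : nat.

Definition l2 (f : seq 'I_n -> E) : Prop :=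
  exists c : R, forall N, wsum_lt N (fun w => nrm2 ip (f w)) <= c.

Definition l2nrm2 (f : seq 'I_n -> E) : R :=
  sup [set x : R | exists N, x = wsum_lt N (fun w => nrm2 ip (f w))].

(* S_i (x) I : e_w (x) x |-> e_{g_i w} (x) x *)
Definition shiftS (i : 'I_n) (f : seq 'I_n -> E) (w : seq 'I_n) : E :=
  if w is j :: w' then (if j == i then f w' else 0) else 0.

(* 1 (x) h = e_{g_0} (x) h *)
Definition vac (h : E) (w : seq 'I_n) : E := if w == [::] then h else 0.

(* M is a bounded operator on F^2(H_n) (x) E commuting with every S_i (x) I,
   i.e. M in R_n^infty bar(x) B(E) (only its values on l2 matter). *)
Definition multi_analytic (M : (seq 'I_n -> E) -> (seq 'I_n -> E)) : Prop :=
  [/\ (forall f, l2 f -> l2 (M f)),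
      (forall (a : C) f g, l2 f -> l2 g ->
          M (fun w => a *: f w + g w) = (fun w => a *: M f w + M g w)),
      (exists c : R, forall f, l2 f -> l2nrm2 (M f) <= c * l2nrm2 f) &
      (forall i f, l2 f -> M (shiftS i f) = shiftS i (M f))].

(* theta is the symbol of M : M (1 (x) h) = theta h. *)
Definition is_symbol (M : (seq 'I_n -> E) -> (seq 'I_n -> E))
  (theta : seq 'I_n -> E -> E) : Prop :=
  forall h : E, M (vac h) = (fun w => theta (rev w) h).

End MultiAnalytic.

End Defs.

(* Main.v *)
(** For a finitely supported family [h_s] with [h_{g_0} = h], the quadratic
    expression in the definition of [Delta_K] is the squared norm of
    [F = sum_s (S_s (x) I) theta h_s].  In the words of length [k] only the
    term [s = g_0] contributes, so that [F] agrees there with [theta h], and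
    [|F|^2 >= sum_{|alpha| = k} |theta_alpha h|^2]; take the infimum.
    For the entropy one also needs that the infimum is a quadratic form: by
    the parallelogram law, almost minimising families for the basis vectors
    have a Gram matrix close to the polarised matrix of [Delta_K].  The latter
    thus dominates the matrix of the leading form, and determinants are
    monotone on positive hermitian matrices. *)

Require Import Defs.
From HB Require Import structures.
From mathcomp Require Import all_boot all_order all_algebra.
From mathcomp Require Import complex sesquilinear spectral.
From mathcomp Require Import all_classical all_reals.
From mathcomp Require Import topology normedtype sequences exp.
From mathcomp Require Import ring lra.
Import Order.TTheory GRing.Theory Num.Theory.
Import numFieldNormedType.Exports.
Local Open Scope ring_scope.
Local Open Scope complex_scope.

Set Implicit Arguments. Unset Strict Implicit. Unset Printing Implicit Defensive.

(** * Determinants of hermitian matrices *)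

Section DetMonotone.
Variable C : numClosedFieldType.
Local Open Scope sesquilinear_scope.

Let qf n (A : 'M[C]_n) (v : 'rV[C]_n) : C := (v *m A *m v^t*) 0 0.

Lemma hermitian_spectral n (A : 'M[C]_n) : A^t* = A ->
  A = (spectralmx A)^t* *m diag_mx (spectral_diag A) *m spectralmx A.
Proof.
move=> hA; have : A \is hermsymmx by apply/is_hermitianmxP; rewrite expr0 scale1r hA.
move=> /hermitian_normalmx /orthomx_spectralP {1}->.
by rewrite invmx_unitary ?spectral_unitarymx.
Qed.

Lemma det_spectral n (A : 'M[C]_n) : A^t* = A ->
  \det A = \prod_i spectral_diag A 0 i.
Proof.
move=> hA; rewrite {1}(hermitian_spectral hA) !det_mulmx det_diag mulrAC -det_mulmx.
rewrite -invmx_unitary ?spectral_unitarymx // mulVmx ?spectral_unit //.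
by rewrite det1 mul1r.
Qed.

Lemma spectral_conj n (A : 'M[C]_n) : A^t* = A ->
  spectralmx A *m A *m (spectralmx A)^t* = diag_mx (spectral_diag A).
Proof.
move=> hA; rewrite {2}(hermitian_spectral hA).
have /unitarymxP PP := spectral_unitarymx A.
by rewrite !mulmxA PP mul1mx -mulmxA PP mulmx1.
Qed.

Lemma trmxC_mul m n p (A : 'M[C]_(m, n)) (B : 'M[C]_(n, p)) :
  (A *m B)^t* = B^t* *m A^t*.
Proof. by rewrite trmx_mul map_mxM. Qed.

(** The [i]-th row of the unitary matrix [spectralmx A] is a unit vector at which the form of [A]
    takes the [i]-th eigenvalue as its value. *)
Lemma spectral_diag_ge n (A : 'M[C]_n) (c : C) i : A^t* = A ->
  (forall v, c * (v *m v^t*) 0 0 <= qf A v) -> c <= spectral_diag A 0 i.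
Proof.
move=> hA /(_ (row i (spectralmx A))); rewrite /qf.
set P := spectralmx A.
have -> : row i P *m (row i P)^t* = delta_mx 0 i *m (P *m P^t*) *m delta_mx i 0.
  by rewrite rowE trmxC_mul trmx_delta map_delta_mx !mulmxA.
have -> : row i P *m A *m (row i P)^t* =
    delta_mx 0 i *m (P *m A *m P^t*) *m delta_mx i 0.
  by rewrite rowE trmxC_mul trmx_delta map_delta_mx !mulmxA.
rewrite spectral_conj // (unitarymxP (spectral_unitarymx A)) mulmx1 mul_delta_mx.
rewrite -rowE row_diag_mx -scalemxAl mul_delta_mx !mxE eqxx /=.
by rewrite !mulr1.
Qed.

(* The congruence by [diag (b_i^(-1/2)) P], with [b_i] the eigenvalues of [B],
   reduces to the case [B = 1]. *)
Lemma det_le n (A B : 'M[C]_n) : A^t* = A -> B^t* = B ->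
  (forall v, 0 <= qf B v) -> (forall v, qf B v <= qf A v) -> \det B <= \det A.
Proof.
move=> hA hB B0 BA.
have Bd i : 0 <= spectral_diag B 0 i.
  by apply: spectral_diag_ge => // v; rewrite mul0r.
have [dB0|dBN0] := eqVneq (\det B) 0.
  rewrite dB0 (det_spectral hA) prodr_ge0 // => i _; apply: spectral_diag_ge => // v.
  by rewrite mul0r; exact: le_trans (BA v).
have Bp i : 0 < spectral_diag B 0 i.
  rewrite lt_def Bd andbT; apply: contraNneq dBN0 => b0.
  by rewrite det_spectral // (bigD1 i) //= b0 mul0r.
pose s : 'rV[C]_n := \row_i (sqrtC (spectral_diag B 0 i))^-1.
pose S := diag_mx s *m spectralmx B.
have sC : (diag_mx s)^t* = diag_mx s.
  rewrite tr_diag_mx map_diag_mx; congr diag_mx; apply/rowP => i; rewrite !mxE.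
  by apply/CrealP; rewrite realV ger0_real // sqrtC_ge0.
have SBS : S *m B *m S^t* = 1%:M.
  have -> : S *m B *m S^t* =
      diag_mx s *m (spectralmx B *m B *m (spectralmx B)^t*) *m diag_mx s.
    by rewrite /S trmxC_mul sC !mulmxA.
  rewrite spectral_conj // !mulmx_diag; apply/matrixP => i j; rewrite !mxE.
  have bp := Bp i.
  have sp : sqrtC (spectral_diag B 0 i) != 0 by rewrite sqrtC_eq0 gt_eqF.
  case: (i == j); last by rewrite !mulr0n.
  rewrite !mulr1n -[X in _ * X * _]sqrtCK.
  by rewrite expr2 mulrA mulVf // mul1r mulfV.
clearbody S => {s sC}.
have hS : (S *m A *m S^t*)^t* = S *m A *m S^t*.
  by rewrite !trmxC_mul trmxCK hA mulmxA.
(* The congruent matrix dominates the identity, so each of its eigenvalues is at least 1. *)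
have dS1 : 1 <= \det (S *m A *m S^t*).
  rewrite (det_spectral hS).
  have {1}<- : \prod_(i < n) 1 = 1 :> C by rewrite big1.
  apply: ler_prod => i _; rewrite ler01 /=.
  apply: spectral_diag_ge => // v; rewrite mul1r.
  have := BA (v *m S); rewrite /qf trmxC_mul.
  have E (M : 'M[C]_n) : v *m S *m M *m (S^t* *m v^t*) = v *m (S *m M *m S^t*) *m v^t*.
    by rewrite !mulmxA.
  by rewrite !E SBS mulmx1.
have dS0 : 0 <= \det S * \det (S^t*).
  by rewrite det_map_mx det_tr -normCK exprn_ge0.
have d1 : \det S * \det (S^t*) * \det B = 1.
  by rewrite mulrAC -!det_mulmx SBS det1.
have dp : 0 < \det S * \det (S^t*).
  by rewrite lt_def dS0 andbT; apply: contra_eqN d1 => /eqP ->; rewrite mul0r eq_sym oner_eq0.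
by rewrite -(ler_pM2l dp) d1 mulrAC -!det_mulmx.
Qed.

End DetMonotone.

(** * Real and imaginary parts *)

Section ComplexParts.
Variable R : realType.
Implicit Types a b : R[i].

Lemma RecD a b : complex.Re (a + b) = complex.Re a + complex.Re b.
Proof. by case: a b => [? ?] [? ?]. Qed.

Lemma RecN a : complex.Re (- a) = - complex.Re a. Proof. by case: a. Qed.

Lemma ImcD a b : complex.Im (a + b) = complex.Im a + complex.Im b.
Proof. by case: a b => [? ?] [? ?]. Qed.

Lemma Rec_sum (I : Type) (r : seq I) (P : pred I) (F : I -> R[i]) :
  complex.Re (\sum_(i <- r | P i) F i) = \sum_(i <- r | P i) complex.Re (F i).
Proof. by apply: big_morph => //; exact: RecD. Qed.

Lemma RecM a b : complex.Re (a * b) =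
  complex.Re a * complex.Re b - complex.Im a * complex.Im b.
Proof. by case: a b => [? ?] [? ?]. Qed.

Lemma ImcM a b : complex.Im (a * b) =
  complex.Re a * complex.Im b + complex.Im a * complex.Re b.
Proof. by case: a b => [? ?] [? ?]. Qed.

Lemma RecJ a : complex.Re (conjc a) = complex.Re a. Proof. by case: a. Qed.

Lemma ImcJ a : complex.Im (conjc a) = - complex.Im a. Proof. by case: a. Qed.

Lemma complex_eqP a b :
  complex.Re a = complex.Re b -> complex.Im a = complex.Im b -> a = b.
Proof. by case: a b => [? ?] [? ?] /= -> ->. Qed.

End ComplexParts.

(** * Infimum of a positive form over the fibres of a linear relation *)

Section InfimumForm.
Variables (R : realType) (E V : lmodType R[i]).
Variables (A : E -> V -> Prop) (L : V -> V -> R[i]).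
Hypothesis A_lin : forall (a : R[i]) x y u v,
  A x u -> A y v -> A (a *: x + y) (a *: u + v).
Hypothesis A_ex : forall x, exists u, A x u.
(** The laws of [L] are asked only on the range of [A]: in the application [L] is a sum over words,
    which is known to converge for square-summable families. *)
Hypothesis L_lin : forall (a : R[i]) x y z u v w,
  A x u -> A y v -> A z w -> L (a *: u + v) w = a * L u w + L v w.
Hypothesis L_conj : forall x y u v, A x u -> A y v -> L v u = conjc (L u v).
Hypothesis L_ge0 : forall x u, A x u -> 0 <= complex.Re (L u u).

Definition qinf (x : E) : R :=
  inf [set t : R | exists u, A x u /\ t = complex.Re (L u u)].

(** Polarisation of [qinf]; with [b j] and [b i] as arguments this has the shape of the [(i, j)]
    entry of [DeltaMx]. *)
Let B (x y : E) : R[i] :=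
  (4%:R)^-1 * \sum_(l < 4) 'i ^+ l * (qinf (x + 'i ^+ l *: y))%:C.

Lemma A_00 : A 0 0.
Proof.
have [u Au] := A_ex 0; have := A_lin (-1) Au Au.
by rewrite !scaleN1r !addNr.
Qed.

Lemma A_scale (a : R[i]) x u : A x u -> A (a *: x) (a *: u).
Proof. by move=> /(A_lin a)/(_ A_00); rewrite !addr0. Qed.

Lemma A_add x y u v : A x u -> A y v -> A (x + y) (u + v).
Proof. by move=> /(A_lin 1) h /h; rewrite !scale1r. Qed.

Lemma L_linr (a : R[i]) x y z u v w : A x u -> A y v -> A z w ->
  L w (a *: u + v) = conjc a * L w u + L w v.
Proof.
move=> Au Av Aw; rewrite (L_conj (A_lin a Au Av) Aw) (L_lin a Au Av Aw).
by rewrite rmorphD rmorphM /= (L_conj Au Aw) (L_conj Av Aw).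
Qed.

Lemma L_0l y v : A y v -> L 0 v = 0.
Proof.
move=> Av; have := L_lin 1 A_00 A_00 Av; rewrite scaler0 add0r mul1r.
by move=> /eqP; rewrite eq_sym -subr_eq0 addrK => /eqP.
Qed.

Lemma L_Zl (a : R[i]) x y u v : A x u -> A y v -> L (a *: u) v = a * L u v.
Proof. by move=> Au Av; have := L_lin a Au A_00 Av; rewrite !addr0 (L_0l Av) addr0. Qed.

Lemma L_Zr (a : R[i]) x y u v : A x u -> A y v -> L v (a *: u) = conjc a * L v u.
Proof.
move=> Au Av.
by rewrite (L_conj (A_scale a Au) Av) (L_Zl a Au Av) rmorphM (L_conj Au Av).
Qed.

Lemma L_real x u : A x u -> L u u = (complex.Re (L u u))%:C.
Proof.
move=> Au; apply: complex_eqP => //=; have := L_conj Au Au.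
by move=> /(congr1 (@complex.Im R)); rewrite ImcJ; lra.
Qed.

Lemma Re_L_add (c : R[i]) x y u v : A x u -> A y v ->
  complex.Re (L (u + c *: v) (u + c *: v)) = complex.Re (L u u) +
    complex.Re (c * conjc c) * complex.Re (L v v) + 2 * complex.Re (conjc c * L u v).
Proof.
move=> Au Av; rewrite [u + _]addrC; have Aw := A_lin c Av Au.
rewrite (L_lin c Av Au Aw) (L_linr c Av Au Av) (L_linr c Av Au Au).
rewrite (L_conj Au Av) (L_real Au) (L_real Av).
by clear Aw; case: (L u v) c => [p q] [s t] /=; ring.
Qed.

Lemma qinf_has_inf x :
  has_inf [set t : R | exists u, A x u /\ t = complex.Re (L u u)].
Proof.
split; first by have [u Au] := A_ex x; exists (complex.Re (L u u)), u.
by exists 0 => t [u [Au ->]]; exact: L_ge0 Au.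
Qed.

Lemma qinf_le x u : A x u -> qinf x <= complex.Re (L u u).
Proof. by move=> Au; apply: ge_inf (proj2 (qinf_has_inf x)) _ _; exists u. Qed.

Lemma qinf_ge x (c : R) :
  (forall u, A x u -> c <= complex.Re (L u u)) -> c <= qinf x.
Proof.
move=> h; apply: lb_le_inf; first exact: (proj1 (qinf_has_inf x)).
by move=> t [u [Au ->]]; exact: h.
Qed.

Lemma qinf_adherent x (e : R) : 0 < e ->
  exists2 u, A x u & complex.Re (L u u) <= qinf x + e.
Proof.
move=> e0; have [t [u [Au ->]] h] := inf_adherent e0 (qinf_has_inf x).
by exists u => //; exact: ltW.
Qed.

(** Multiplication by [conjc c] carries the fibre over [c *: x] into the fibre over [x] and
    preserves the energy. *)
Lemma qinf_phase (c : R[i]) x : c * conjc c = 1 -> qinf x <= qinf (c *: x).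
Proof.
move=> c1; apply: qinf_ge => u Au.
have := A_scale (conjc c) Au; rewrite scalerA mulrC c1 scale1r => Au'.
have := qinf_le Au'; rewrite (L_Zl _ Au Au') (L_Zr _ Au Au) conjcK mulrA.
by rewrite [conjc c * c]mulrC c1 mul1r.
Qed.

Lemma half_scale (W : lmodType R[i]) (x y : W) :
  (2^-1 : R[i]) *: (x + y) + (2^-1 : R[i]) *: (x - y) = x /\
  (2^-1 : R[i]) *: (x + y) + (- 2^-1 : R[i]) *: (x - y) = y.
Proof.
have two z : (2^-1 : R[i]) *: (z + z) = z :> W.
  by rewrite -[z + z]mulr2n -[z *+ 2]scaler_nat scalerA mulVf ?pnatr_eq0 // scale1r.
rewrite scaleNr -scalerDr -scalerBr opprB addrACA subrr addr0.
by rewrite [x + y]addrC addrACA subrr addr0 !two.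
Qed.

(** Half the sum and half the difference of near-minimisers over [x + y] and [x - y] lie over [x]
    and [y]; the parallelogram law for [L] compares the energies. *)
Lemma qinf_parallelogram x y :
  2 * qinf x + 2 * qinf y <= qinf (x + y) + qinf (x - y).
Proof.
apply/ler_addgt0Pr => e e0; have e20 : 0 < e / 2 by lra.
have [u Au hu] := qinf_adherent (x + y) e20.
have [v Av hv] := qinf_adherent (x - y) e20.
have A1 := A_lin (2^-1) Au (A_scale (2^-1) Av).
have A2 := A_lin (2^-1) Au (A_scale (- 2^-1) Av).
rewrite (half_scale x y).1 in A1; rewrite (half_scale x y).2 in A2.
have Au2 := A_scale 2^-1 Au.
have h1 := qinf_le A1; have h2 := qinf_le A2.
rewrite (Re_L_add _ Au2 Av) in h1; rewrite (Re_L_add _ Au2 Av) in h2.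
rewrite (L_Zl _ Au Av) (L_Zl _ Au Au2) (L_Zr _ Au Au) in h1 h2.
have c2 : (2^-1 : R[i]) = (2^-1 : R)%:C by rewrite fmorphV rmorph_nat.
rewrite c2 in h1 h2; rewrite (L_real Au) (L_real Av) in hu hv h1 h2.
case: (L u v) h1 h2 => [p q] /=.
move: hu hv => /=.
set s := complex.Re _; set t := complex.Re _ => hu hv h1 h2.
lra.
Qed.

(** The energies of [u + c *: v] and [u - c *: v] add up to at most
    [2 * qinf x + 2 * qinf y + 4 * e], hence exceed the sum of the two infima by at most [4 * e].
    Both excesses are nonnegative, so each one is at most [4 * e]. *)
Lemma near_min (c : R[i]) (e : R) x y u v : c * conjc c = 1 ->
  A x u -> A y v ->
  complex.Re (L u u) <= qinf x + e -> complex.Re (L v v) <= qinf y + e ->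
  `|complex.Re (L (u + c *: v) (u + c *: v)) - qinf (x + c *: y)| <= 4 * e.
Proof.
move=> c1 Au Av hu hv.
have Ap := A_add Au (A_scale c Av).
have Am := A_add Au (A_scale (- c) Av).
have hp := qinf_le Ap; have hm := qinf_le Am.
have pl := qinf_parallelogram x (c *: y); rewrite -scaleNr in pl.
have ph := qinf_phase y c1.
rewrite ger0_norm ?subr_ge0 //.
rewrite (Re_L_add _ Au Av) in hp *; rewrite (Re_L_add _ Au Av) in hm.
rewrite rmorphN mulrNN c1 !mulNr /= mul1r in hm *.
move: hm hp; rewrite c1 /=; case: (conjc c * L u v) => p q /=; lra.
Qed.

Lemma L_polarization x y u v : A x u -> A y v ->
  L u v = (4%:R)^-1 * \sum_(l < 4)
    'i ^+ l * (complex.Re (L (u + 'i ^+ l *: v) (u + 'i ^+ l *: v)))%:C.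
Proof.
move=> Au Av; apply: (@mulfI _ (4%:R : R[i])); first by rewrite pnatr_eq0.
rewrite mulrA mulfV ?pnatr_eq0 // mul1r.
rewrite !big_ord_recl big_ord0 /= !(Re_L_add _ Au Av).
rewrite !(rmorph1, expr0, exprS, mulr1, mul1r).
have -> : (4%:R : R[i]) = (4 : R)%:C by rewrite rmorph_nat.
set s := complex.Re _; set t := complex.Re _.
by case: (L u v) => [p q] /=; apply: complex_eqP => /=; ring.
Qed.

Lemma iX_unit l : ('i ^+ l : R[i]) * conjc ('i ^+ l) = 1.
Proof.
rewrite rmorphXn -exprMn /=; have -> : 'i * conjc 'i = 1 :> R[i] by apply: complex_eqP => /=; ring.
by rewrite expr1n.
Qed.

Lemma normc_unit (c : R[i]) : c * conjc c = 1 -> `|c| = 1.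
Proof.
move=> c1; apply/eqP; rewrite -(@pexpr_eq1 _ _ 2) // sqr_normc.
exact/eqP.
Qed.

(** Polarise both sides: by [near_min] each of the four terms is off by at most [4 * e], and the
    factor 1/4 averages these errors. *)
Lemma L_near_qinf (e : R) x y u v : A x u -> A y v ->
  complex.Re (L u u) <= qinf x + e -> complex.Re (L v v) <= qinf y + e ->
  `|L u v - B x y| <= (4 * e)%:C.
Proof.
move=> Au Av hu hv; rewrite (L_polarization Au Av) /B -mulrBr -sumrB normrM.
rewrite ger0_norm ?invr_ge0 ?ler0n // ler_pdivrMl ?ltr0n //.
apply: le_trans (ler_norm_sum _ _ _) _.
have -> : 4%:R * (4 * e)%:C = \sum_(l < 4) (4 * e)%:C :> R[i].
  by rewrite mulr_natl sumr_const card_ord.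
apply: ler_sum => l _; rewrite -mulrBr normrM (normc_unit (iX_unit l)) mul1r.
rewrite -rmorphB normc_def /= expr0n addr0 sqrtr_sqr lecR.
exact: near_min (iX_unit l) Au Av hu hv.
Qed.

Lemma A_sum (I : finType) (r : seq I) (z : I -> R[i]) (x : I -> E) (u : I -> V) :
  (forall i, A (x i) (u i)) ->
  A (\sum_(i <- r) z i *: x i) (\sum_(i <- r) z i *: u i).
Proof.
move=> Au; apply: (big_ind2 A); first exact: A_00.
- by move=> *; exact: A_add.
- by move=> i _; exact: A_scale.
Qed.

Lemma L_suml (I : finType) (r : seq I) (z : I -> R[i]) (x : I -> E) (u : I -> V) y v :
  (forall i, A (x i) (u i)) -> A y v ->
  L (\sum_(i <- r) z i *: u i) v = \sum_(i <- r) z i * L (u i) v.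
Proof.
move=> Au Av; elim: r => [|i r ih]; first by rewrite !big_nil (L_0l Av).
by rewrite !big_cons (L_lin _ (Au i) (A_sum r z Au) Av) ih.
Qed.

Lemma L_expand (I : finType) (z : I -> R[i]) (x : I -> E) (u : I -> V) :
  (forall i, A (x i) (u i)) ->
  L (\sum_i z i *: u i) (\sum_i z i *: u i) =
  \sum_j \sum_i z j * conjc (z i) * L (u j) (u i).
Proof.
move=> Au; have As := A_sum (index_enum I) z Au.
rewrite (L_suml _ _ Au As); apply: eq_bigr => j _.
rewrite (L_conj As (Au j)) (L_suml _ _ Au (Au j)) rmorph_sum mulr_sumr.
by apply: eq_bigr => i _; rewrite rmorphM /= -(L_conj (Au i) (Au j)) mulrA.
Qed.

Lemma small_complex_eq0 (z : R[i]) :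
  (forall e : R, 0 < e -> `|z| <= e%:C) -> z = 0.
Proof.
move=> h; apply/eqP; rewrite -normr_eq0 normc_def; apply/eqP; congr (_%:C).
apply/eqP; rewrite eq_le sqrtr_ge0 andbT; apply/ler_addgt0Pr => e e0.
by rewrite add0r -lecR -normc_def; exact: h.
Qed.

Lemma qinf_form_conj x y : B y x = conjc (B x y).
Proof.
apply/eqP; rewrite -subr_eq0; apply/eqP/small_complex_eq0 => e e0.
(* Two estimates follow, each with error [4 * (e / 8)]. *)
have e80 : 0 < e / 8 by lra.
have [u Au hu] := qinf_adherent x e80.
have [v Av hv] := qinf_adherent y e80.
have h1 := L_near_qinf Au Av hu hv; have h2 := L_near_qinf Av Au hv hu.
rewrite -normcJ rmorphB /= -(L_conj Au Av) in h1.
have -> : B y x - conjc (B x y) =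
  (L v u - conjc (B x y)) - (L v u - B y x) by ring.
apply: le_trans (ler_normB _ _) _; apply: le_trans (lerD h1 h2) _.
by rewrite -rmorphD lecR; lra.
Qed.

Variable S : E -> E -> R[i].
Hypothesis S_lin : forall (a : R[i]) x y z, S (a *: x + y) z = a * S x z + S y z.
Hypothesis S_conj : forall x y, S y x = conjc (S x y).
Hypothesis S_le : forall x u, A x u -> complex.Re (S x x) <= complex.Re (L u u).

(** Take near-minimisers [u i] over [x i]. Their combination lies over the combination of the [x i],
    so its energy bounds [S] from above; expanded through the Gram matrix of the [u i], this energy
    is close to the value of the polarised form. *)
Lemma qinf_form_ge (I : finType) (z : I -> R[i]) (x : I -> E) :
  complex.Re (S (\sum_i z i *: x i) (\sum_i z i *: x i)) <=
  complex.Re (\sum_j \sum_i z j * conjc (z i) * B (x j) (x i)).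
Proof.
pose K : R := \sum_j \sum_i complex.Re `|z j * conjc (z i)|.
have normRe (c : R[i]) : `|c| = (complex.Re `|c|)%:C by rewrite normc_def.
have K0 : 0 <= K.
  apply: sumr_ge0 => j _; apply: sumr_ge0 => i _.
  by rewrite -lecR -normRe normr_ge0.
(* Each Gram entry is off by at most [4 * d], so the total error is at most [4 * d * K], which this
   [d] keeps below [e]; [K + 1] avoids a zero denominator. *)
apply/ler_addgt0Pr => e e0; pose d := e / (4 * (K + 1)).
have d0 : 0 < d by apply: divr_gt0 => //; lra.
have /choice[u hu] : forall i, exists u, A (x i) u /\
    complex.Re (L u u) <= qinf (x i) + d.
  by move=> i; have [u ? ?] := qinf_adherent (x i) d0; exists u.
have Au i : A (x i) (u i) := (hu i).1.
apply: le_trans (S_le (A_sum _ z Au)) _; rewrite (L_expand z Au).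
rewrite -lerBlDl !Rec_sum -sumrB.
apply: le_trans (_ : 4 * d * K <= e); last first.
  rewrite /d mulrA mulrAC ler_pdivrMr; last by lra.
  by nra.
rewrite /K mulr_sumr; apply: ler_sum => j _.
rewrite !Rec_sum -sumrB mulr_sumr; apply: ler_sum => i _.
set c := z j * _; have := L_near_qinf (Au j) (Au i) (hu j).2 (hu i).2.
move/(ler_wpM2l (normr_ge0 c)); rewrite -normrM mulrBr => h.
have := le_trans (normc_ge_Re _) h.
rewrite [`|c|]normRe -rmorphM lecR RecD RecN => h2.
apply: le_trans (le_trans (ler_norm _) h2) _.
by rewrite mulrC.
Qed.

End InfimumForm.

(** * Gram matrices of hermitian forms *)

Section FormMatrix.
Variables (R : realType) (E : Type).
Implicit Types F G : E -> E -> R[i].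

(** Entry [(i, j)] pairs [x j] with [x i], so the row vector [v] evaluates the form at the
    coefficients [z i = conjc (v 0 i)]. The double conjugate keeps the shape [z j * conjc (z i)]. *)
Lemma form_mx_qf (m : nat) F (x : 'I_m -> E) (v : 'rV[R[i]]_m) :
  (v *m (\matrix_(i, j) F (x j) (x i)) *m map_mx Num.conj v^T) 0 0 =
  \sum_j \sum_i conjc (v 0 j) * conjc (conjc (v 0 i)) * F (x j) (x i).
Proof.
rewrite mxE; apply: eq_bigr => j _; rewrite !mxE mulr_suml; apply: eq_bigr => i _.
by rewrite !mxE conjcK [conjc _ * _]mulrC mulrAC.
Qed.

Lemma form_mx_herm (m : nat) F (x : 'I_m -> E) : (forall y z, F z y = conjc (F y z)) ->
  map_mx Num.conj (\matrix_(i, j) F (x j) (x i))^T = \matrix_(i, j) F (x j) (x i).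
Proof. by move=> hF; apply/matrixP => i j; rewrite !mxE; exact/esym/hF. Qed.

(** The order of [R[i]] relates only numbers with equal imaginary parts; this lets inequalities
    between real parts be read in [R[i]]. *)
Lemma form_sum_real (I : finType) F (x : I -> E) (z : I -> R[i]) :
  (forall y y', F y' y = conjc (F y y')) ->
  complex.Im (\sum_j \sum_i z j * conjc (z i) * F (x j) (x i)) = 0.
Proof.
move=> hF; set q := \sum_j _.
have hq : conjc q = q.
  have qE : q = \sum_i \sum_j z j * conjc (z i) * F (x j) (x i).
    exact: exchange_big.
  rewrite [RHS]qE rmorph_sum /=; apply: eq_bigr => j _.
  rewrite rmorph_sum /=; apply: eq_bigr => i _.
  by rewrite !rmorphM /= !conjcK -hF; ring.
by move/(congr1 (@complex.Im R)): hq; rewrite ImcJ; lra.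
Qed.

Lemma det_form_le (m : nat) F G (x : 'I_m -> E) :
  (forall y z, F z y = conjc (F y z)) -> (forall y z, G z y = conjc (G y z)) ->
  (forall z : 'I_m -> R[i],
    0 <= complex.Re (\sum_j \sum_i z j * conjc (z i) * F (x j) (x i))) ->
  (forall z : 'I_m -> R[i],
    complex.Re (\sum_j \sum_i z j * conjc (z i) * F (x j) (x i)) <=
    complex.Re (\sum_j \sum_i z j * conjc (z i) * G (x j) (x i))) ->
  complex.Re (\det (\matrix_(i, j) F (x j) (x i))) <=
  complex.Re (\det (\matrix_(i, j) G (x j) (x i))).
Proof.
move=> hF hG F0 FG.
have : (\det (\matrix_(i, j) F (x j) (x i)) <=
  \det (\matrix_(i, j) G (x j) (x i)) :> R[i]).
  apply: det_le; [exact: form_mx_herm|exact: form_mx_herm| |] => v;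
    rewrite !form_mx_qf lecE !form_sum_real ?eqxx //=.
by rewrite lecE => /andP[].
Qed.

End FormMatrix.

(** * Sums over words *)

Section WordSums.
Variable n : nat.

Section Nmod.
Variable V : nmodType.
Implicit Types f g : seq 'I_n -> V.

Lemma eq_wsum_eq j f g : (forall w, size w = j -> f w = g w) ->
  wsum_eq j f = wsum_eq j g.
Proof. by move=> fg; apply: eq_bigr => t _; rewrite fg ?size_tuple. Qed.

Lemma eq_wsum_lt N f g : (forall w, (size w < N)%N -> f w = g w) ->
  wsum_lt N f = wsum_lt N g.
Proof. by move=> fg; apply: eq_bigr => j _; apply: eq_wsum_eq => w sw; rewrite fg ?sw. Qed.

Lemma wsum_eq_nil f : wsum_eq 0 f = f [::].
Proof.
rewrite /wsum_eq (big_pred1 ([tuple] : 0.-tuple 'I_n)) // => t /=.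
by apply/esym/eqP; rewrite [t]tuple0.
Qed.

Lemma wsum_eqS j f : wsum_eq j.+1 f = \sum_a wsum_eq j (fun w => f (a :: w)).
Proof.
rewrite pair_big /wsum_eq /=.
rewrite (reindex (fun p : 'I_n * j.-tuple 'I_n => [tuple of p.1 :: p.2])) //=.
exists (fun t : j.+1.-tuple 'I_n => (thead t, [tuple of behead t])).
  by move=> [a t] _ /=; congr (_, _); apply: val_inj.
by move=> t _ /=; rewrite [RHS]tuple_eta; apply: val_inj.
Qed.

(** Used to pass between [theta_alpha] and the coefficient of [theta h] at the reversed word. *)
Lemma wsum_eq_rev j f : wsum_eq j (fun w => f (rev w)) = wsum_eq j f.
Proof.
rewrite /wsum_eq [RHS](reindex (fun t : j.-tuple 'I_n => [tuple of rev t])) //=.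
by exists (fun t : j.-tuple 'I_n => [tuple of rev t]) => t _; apply: val_inj => /=; rewrite revK.
Qed.

Lemma wsum_ltS N f : wsum_lt N.+1 f = wsum_lt N f + wsum_eq N f.
Proof. by rewrite /wsum_lt big_ord_recr. Qed.

Lemma wsum_ltS_cons N f :
  wsum_lt N.+1 f = f [::] + \sum_a wsum_lt N (fun w => f (a :: w)).
Proof.
rewrite /wsum_lt big_ord_recl wsum_eq_nil; congr (_ + _).
by rewrite exchange_big; apply: eq_bigr => j _; rewrite wsum_eqS.
Qed.

Lemma wsum_lt_pad N M f : (N <= M)%N -> (forall w, (N <= size w)%N -> f w = 0) ->
  wsum_lt M f = wsum_lt N f.
Proof.
move=> /subnKC <- f0; elim: (M - N)%N => [|d ih]; first by rewrite addn0.
rewrite addnS wsum_ltS ih [wsum_eq _ _]big1 ?addr0 // => t _.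
by rewrite f0 // size_tuple leq_addr.
Qed.

End Nmod.

Lemma wsum_lt_morph (V W : nmodType) (g : V -> W) N (f : seq 'I_n -> V) :
  g 0 = 0 -> {morph g : x y / x + y} ->
  g (wsum_lt N f) = wsum_lt N (fun w => g (f w)).
Proof.
by move=> g0 gD; rewrite [LHS](big_morph g gD g0); apply: eq_bigr => j _; exact: big_morph.
Qed.

Lemma wsum_eq_morph (V W : nmodType) (g : V -> W) N (f : seq 'I_n -> V) :
  g 0 = 0 -> {morph g : x y / x + y} ->
  g (wsum_eq N f) = wsum_eq N (fun w => g (f w)).
Proof. by move=> g0 gD; exact: big_morph. Qed.

Lemma wsum_lt_ind2 (V W : nmodType) (K : V -> W -> Prop) N
    (f : seq 'I_n -> V) (g : seq 'I_n -> W) :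
  K 0 0 -> (forall x x' y y', K x x' -> K y y' -> K (x + y) (x' + y')) ->
  (forall w, K (f w) (g w)) -> K (wsum_lt N f) (wsum_lt N g).
Proof.
by move=> K0 KD fg; apply: big_ind2 => // j _; apply: big_ind2 => // t _; exact: fg.
Qed.

Lemma wsum_ltE (T : Type) (V : nmodType) N (f : seq 'I_n -> T -> V) x :
  wsum_lt N f x = wsum_lt N (fun w => f w x).
Proof. exact: (wsum_lt_morph (g := fun u : T -> V => u x)). Qed.

Lemma wsum_ltD (V : nmodType) N (f g : seq 'I_n -> V) :
  wsum_lt N (fun w => f w + g w) = wsum_lt N f + wsum_lt N g.
Proof. by rewrite -big_split; apply: eq_bigr => j _; rewrite -big_split. Qed.

Lemma wsum_eqD (V : nmodType) N (f g : seq 'I_n -> V) :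
  wsum_eq N (fun w => f w + g w) = wsum_eq N f + wsum_eq N g.
Proof. by rewrite -big_split. Qed.

Section Num.
Variable R : numDomainType.
Implicit Types f g : seq 'I_n -> R.

Lemma wsum_eq_ge0 j f : (forall w, 0 <= f w) -> 0 <= wsum_eq j f.
Proof. by move=> f0; apply: sumr_ge0. Qed.

Lemma le_wsum_lt N f g : (forall w, f w <= g w) -> wsum_lt N f <= wsum_lt N g.
Proof. by move=> fg; apply: ler_sum => j _; apply: ler_sum. Qed.

Lemma wsum_lt_homo f : (forall w, 0 <= f w) ->
  {homo (fun N => wsum_lt N f) : N M / (N <= M)%N >-> N <= M}.
Proof.
move=> f0; apply: homo_leq => // [? ? ?|N]; first exact: le_trans.
by rewrite wsum_ltS lerDl wsum_eq_ge0.
Qed.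

Lemma wsum_eq_le_lt k N f : (forall w, 0 <= f w) -> (k < N)%N ->
  wsum_eq k f <= wsum_lt N f.
Proof.
move=> f0 kN; apply: le_trans (wsum_lt_homo f0 kN).
rewrite wsum_ltS lerDr; apply: sumr_ge0 => j _; exact: wsum_eq_ge0.
Qed.

Lemma le_wsum_eq f w : (forall v, 0 <= f v) -> f w <= wsum_eq (size w) f.
Proof.
move=> f0; rewrite /wsum_eq (bigD1 (in_tuple w)) //= lerDl.
exact: sumr_ge0.
Qed.

End Num.

End WordSums.

(** * Convergent complex sums over words *)

Section ComplexSums.
Variables (R : realType) (n : nat).
Local Notation C := R[i].
Implicit Types f g : seq 'I_n -> C.

(** [limn] has a default value when no limit exists, so the algebra of [csum] is done on this
    convergence predicate and transferred by [is_csumE]. *)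
Definition is_csum f (s : C) : Prop :=
  ((fun N => complex.Re (wsum_lt N f)) @ \oo --> complex.Re s)%classic /\
  ((fun N => complex.Im (wsum_lt N f)) @ \oo --> complex.Im s)%classic.

Lemma is_csumE f s : is_csum f s -> csum f = s.
Proof. 
case=> h1 h2; apply: complex_eqP; rewrite /csum /=.
  exact: (@cvg_lim R^o (@norm_hausdorff _ R^o) _ _ _ _ _ h1).
exact: (@cvg_lim R^o (@norm_hausdorff _ R^o) _ _ _ _ _ h2).
Qed.

Lemma is_csum0 : is_csum (fun _ => 0) 0.
Proof.
have E N : wsum_lt N (fun _ : seq 'I_n => 0 : C) = 0.
  by rewrite [LHS]big1 // => j _; exact: big1.
by split; under eq_fun do rewrite E; exact: cvg_cst.
Qed.

Lemma is_csum_lin (a : C) f g s t : is_csum f s -> is_csum g t ->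
  is_csum (fun w => a * f w + g w) (a * s + t).
Proof.
move=> [f1 f2] [g1 g2].
have E N : wsum_lt N (fun w => a * f w + g w) = a * wsum_lt N f + wsum_lt N g.
  by rewrite wsum_ltD -(wsum_lt_morph (g := *%R a)) ?mulr0 //; exact: mulrDr.
split; under eq_fun do rewrite E.
  under eq_fun do rewrite RecD RecM; rewrite RecD RecM.
  by apply: cvgD => //; apply: cvgB; apply: cvgMr.
under eq_fun do rewrite ImcD ImcM; rewrite ImcD ImcM.
by apply: cvgD => //; apply: cvgD; apply: cvgMr.
Qed.

Lemma is_csum_sum (I : Type) (r : seq I) (a : I -> C) (f : I -> seq 'I_n -> C) s :
  (forall i, is_csum (f i) (s i)) ->
  is_csum (fun w => \sum_(i <- r) a i * f i w) (\sum_(i <- r) a i * s i).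
Proof.
move=> fs; elim: r => [|i r ih].
  by rewrite big_nil; under eq_fun do rewrite big_nil; exact: is_csum0.
by rewrite big_cons; under eq_fun do rewrite big_cons; exact: is_csum_lin.
Qed.

Lemma is_csum_conj f s : is_csum f s -> is_csum (fun w => conjc (f w)) (conjc s).
Proof.
move=> [f1 f2].
have E N : wsum_lt N (fun w => conjc (f w)) = conjc (wsum_lt N f).
  by rewrite (wsum_lt_morph (g := @conjc R)) ?rmorph0 //; exact: rmorphD.
split; under eq_fun do rewrite E ?RecJ ?ImcJ; first by rewrite RecJ.
by rewrite ImcJ; exact: cvgN.
Qed.

Lemma is_csum_nonneg (f : seq 'I_n -> R) (c : R) : (forall w, 0 <= f w) ->
  (forall N, wsum_lt N f <= c) -> exists s, is_csum (fun w => (f w)%:C) s.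
Proof.
move=> f0 fc.
have E N : wsum_lt N (fun w => (f w)%:C) = (wsum_lt N f)%:C.
  by rewrite (wsum_lt_morph (g := fun x : R => x%:C)) ?rmorph0 //; exact: rmorphD.
exists (limn (fun N => wsum_lt N f))%:C; split; under eq_fun do rewrite E /=.
  apply: nondecreasing_is_cvgn; first exact: wsum_lt_homo.
  by exists c => _ [N _ <-].
exact: cvg_cst.
Qed.

Lemma is_csum_ge f s (c : R) k : is_csum f s ->
  (forall N, (k <= N)%N -> c <= complex.Re (wsum_lt N f)) -> c <= complex.Re s.
Proof.
move=> [f1 _] h; rewrite -(cvg_lim _ f1) //; apply: limr_ge.
  by apply/cvg_ex; exists (complex.Re s).
by exists k => // N /= kN; exact: h.
Qed.

End ComplexSums.

(** * Square-summable families *)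

Section SquareSummable.
Variables (R : realType) (E : lmodType R[i]) (ip : E -> E -> R[i]).
Hypothesis ip_lin : forall (a : R[i]) x y z, ip (a *: x + y) z = a * ip x z + ip y z.
Hypothesis ip_conj : forall x y, ip y x = conjc (ip x y).
Hypothesis ip_ge0 : forall x, 0 <= ip x x.
Variable n : nat.
Implicit Types u v : seq 'I_n -> E.

(** With the relation that always holds, the polarisation lemmas for [L] specialise to [ip]. *)
Let All (_ _ : E) := True.
Let All_lin (a : R[i]) (x y u v : E) : All x u -> All y v -> All (a *: x + y) (a *: u + v).
Proof. by []. Qed.
Let ip_linA (a : R[i]) x y z (u v w : E) : All x u -> All y v -> All z w ->
  ip (a *: u + v) w = a * ip u w + ip v w.
Proof. by []. Qed.
Let ip_conjA x y (u v : E) : All x u -> All y v -> ip v u = conjc (ip u v).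
Proof. by []. Qed.

Lemma nrm2_ge0 x : 0 <= nrm2 ip x.
Proof. by have := ip_ge0 x; rewrite lecE => /andP[]. Qed.

Lemma ip_nrm2 x : ip x x = (nrm2 ip x)%:C.
Proof. exact: (L_real ip_conjA (x := x)). Qed.

Lemma ip_polarization x y : ip x y = (4%:R)^-1 * \sum_(l < 4)
  'i ^+ l * (nrm2 ip (x + 'i ^+ l *: y))%:C.
Proof. exact: (L_polarization All_lin ip_linA ip_conjA (x := x) (y := y) (u := x) (v := y) I I). Qed.

(** The parallelogram law, with the square of [x - c *: y] dropped as nonnegative. *)
Lemma nrm2_add_le (c : R[i]) x y : nrm2 ip (x + c *: y) <=
  2 * nrm2 ip x + 2 * complex.Re (c * conjc c) * nrm2 ip y.
Proof.
have h c' := Re_L_add All_lin ip_linA ip_conjA c' (x := x) (y := y) (u := x) (v := y) I I.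
have := nrm2_ge0 (x + (- c) *: y); rewrite /nrm2 !h rmorphN mulrNN mulNr RecN /=.
lra.
Qed.

Lemma l2_lin (a : R[i]) u v : l2 ip u -> l2 ip v -> l2 ip (fun w => a *: u w + v w).
Proof.
move=> [c uc] [d vd]; exists (2 * d + 2 * complex.Re (a * conjc a) * c) => N.
have a0 : 0 <= 2 * complex.Re (a * conjc a).
  have := mulcJ_ge0 a; rewrite lecE => /andP[_ /=] ?; lra.
apply: le_trans (lerD (ler_wpM2l (_ : 0 <= 2) (vd N)) (ler_wpM2l a0 (uc N))) => //.
have M (s : R) f : s * wsum_lt N f = wsum_lt N (fun w : seq 'I_n => s * f w).
  by apply: (wsum_lt_morph (g := *%R s)); [exact: mulr0|exact: mulrDr].
rewrite !M -wsum_ltD; apply: le_wsum_lt => w.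
by rewrite [_ *: _ + _]addrC; exact: nrm2_add_le.
Qed.

Lemma nrm2_0 : nrm2 ip 0 = 0.
Proof.
have /eqP := ip_lin 1 0 0 0; rewrite scaler0 addr0 mul1r eq_sym -subr_eq0 addrK.
by rewrite /nrm2 => /eqP ->.
Qed.

Lemma l2_0 : l2 ip (fun _ : seq 'I_n => 0).
Proof.
exists 0 => N; rewrite le_eqVlt; apply/orP; left; apply/eqP.
by rewrite [LHS]big1 // => j _; apply: big1 => t _; exact: nrm2_0.
Qed.

Lemma l2D u v : l2 ip u -> l2 ip v -> l2 ip (fun w => u w + v w).
Proof. by move=> lu lv; have := l2_lin 1 lu lv; under eq_fun do rewrite scale1r. Qed.

(** By polarisation the series is a combination of four series with nonnegative terms and bounded
    partial sums. *)
Lemma l2_ip_summable u v : l2 ip u -> l2 ip v ->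
  exists s, is_csum (fun w => ip (u w) (v w)) s.
Proof.
move=> lu lv.
have h (l : 'I_4) : exists s, is_csum (fun w => (nrm2 ip (u w + 'i ^+ l *: v w))%:C) s.
  have [c hc] := l2_lin ('i ^+ l) lv lu.
  apply: (is_csum_nonneg (c := c)) => [w|N]; first exact: nrm2_ge0.
  by have := hc N; under eq_fun do rewrite addrC.
have [s hs] := choice h; have := is_csum_sum (index_enum _) (fun l : 'I_4 => 'i ^+ l) hs.
move=> /(is_csum_lin (4%:R)^-1)/(_ (is_csum0 _ _)).
under eq_fun do rewrite addr0 -ip_polarization.
by move=> ?; eexists; eassumption.
Qed.

Definition l2form u v : R[i] := csum (fun w => ip (u w) (v w)).

Lemma l2formP u v : l2 ip u -> l2 ip v ->
  is_csum (fun w => ip (u w) (v w)) (l2form u v).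
Proof. by move=> lu /(l2_ip_summable lu)[s hs]; rewrite /l2form (is_csumE hs). Qed.

Lemma l2form_lin (a : R[i]) u v w : l2 ip u -> l2 ip v -> l2 ip w ->
  l2form (fun g => a *: u g + v g) w = a * l2form u w + l2form v w.
Proof.
move=> lu lv lw; apply: is_csumE; under eq_fun do rewrite ip_lin.
by apply: is_csum_lin; exact: l2formP.
Qed.

Lemma l2form_conj u v : l2 ip u -> l2 ip v -> l2form v u = conjc (l2form u v).
Proof.
move=> lu lv; apply: is_csumE; under eq_fun do rewrite ip_conj.
exact/is_csum_conj/l2formP.
Qed.

Lemma l2form_ge k u : l2 ip u ->
  wsum_eq k (fun w => nrm2 ip (u w)) <= complex.Re (l2form u u).
Proof.
(* [wsum_lt N] stops at length [N - 1], so level [k] is included from [k.+1] on. *)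
move=> lu; apply: (is_csum_ge (l2formP lu lu) (k := k.+1)) => N kN.
rewrite (wsum_lt_morph (g := @complex.Re R)) //; last exact: RecD.
by apply: wsum_eq_le_lt => // w; exact: nrm2_ge0.
Qed.

Lemma l2form_ge0 u : l2 ip u -> 0 <= complex.Re (l2form u u).
Proof.
move=> /(l2form_ge 0); apply: le_trans; apply: wsum_eq_ge0 => w; exact: nrm2_ge0.
Qed.

Lemma l2_wsum N (f : seq 'I_n -> seq 'I_n -> E) : (forall s, l2 ip (f s)) ->
  l2 ip (wsum_lt N f).
Proof.
move=> lf; apply: (@wsum_lt_ind2 _ _ nat (fun u _ => l2 ip u) N f (fun=> 0%N)) => //.
  exact: l2_0.
by move=> u _ v _; exact: l2D.
Qed.

Lemma l2form_wsum N (f : seq 'I_n -> seq 'I_n -> E) v : (forall s, l2 ip (f s)) ->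
  l2 ip v -> l2form (wsum_lt N f) v = wsum_lt N (fun s => l2form (f s) v).
Proof.
move=> lf lv.
have D u u' : l2 ip u -> l2 ip u' -> l2form (u + u') v = l2form u v + l2form u' v.
  move=> lu lu'; have := l2form_lin 1 lu lu' lv.
  by under eq_fun do rewrite scale1r; rewrite mul1r.
have Z : l2form 0 v = 0.
  have := D _ _ l2_0 l2_0; rewrite addr0.
  by move=> /eqP; rewrite eq_sym -subr_eq0 addrK => /eqP.
(* Square-summability is carried along in the induction, because additivity [D] requires it. *)
apply: (proj2 (@wsum_lt_ind2 _ (seq 'I_n -> E) R[i]
  (fun u s => l2 ip u /\ l2form u v = s) N f (fun s => l2form (f s) v) _ _ _)).
- by split; [exact: l2_0|exact: Z].
- by move=> u s u' s' [lu <-] [lu' <-]; split; [exact: l2D|exact: D].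
- by move=> s; split.
Qed.

End SquareSummable.

(** * The quadratic form of a symbol *)

Lemma lnE_le (R : realType) (x y : R) : x <= y -> (lnE x <= lnE y)%E.
Proof.
move=> xy; rewrite /lnE; case: (leP x 0) => x0; first exact: leNye.
have y0 := lt_le_trans x0 xy.
by rewrite [y <= 0]leNgt y0 /= lee_fin ler_ln ?posrelE.
Qed.

Section Symbol.
Variables (R : realType) (E : lmodType R[i]) (ip : E -> E -> R[i]).
Hypothesis ip_lin : forall (a : R[i]) x y z, ip (a *: x + y) z = a * ip x z + ip y z.
Hypothesis ip_conj : forall x y, ip y x = conjc (ip x y).
Hypothesis ip_ge0 : forall x, 0 <= ip x x.
Variables (n : nat) (theta : seq 'I_n -> E -> E).
Hypothesis theta_bounded : symbol_bounded ip theta.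
Implicit Types s g w : seq 'I_n.

Let theta_lin alpha (a : R[i]) x y :
  theta alpha (a *: x + y) = a *: theta alpha x + theta alpha y.
Proof. by have [h _] := theta_bounded. Qed.

Let theta0 alpha : theta alpha 0 = 0.
Proof.
have /eqP := theta_lin alpha 1 0 0; rewrite !scale1r addr0 eq_sym -subr_eq0 addrK.
by move/eqP.
Qed.

Lemma Stheta_lin s (a : R[i]) x y g :
  Stheta theta s (a *: x + y) g = a *: Stheta theta s x g + Stheta theta s y g.
Proof. by rewrite /Stheta; case: ifP; rewrite ?theta_lin ?scaler0 ?addr0. Qed.

Lemma Stheta0 s g : Stheta theta s 0 g = 0.
Proof. by rewrite /Stheta theta0 if_same. Qed.

(** Shifting by [s] moves coefficients to longer words, so a truncation captures no more of the
    shifted family than of the original one. The induction strips the first letter of [s]. *)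
Lemma Stheta_partial_sum s h N :
  wsum_lt N (fun g => nrm2 ip (Stheta theta s h g)) <=
  wsum_lt N (fun g => nrm2 ip (theta g h)).
Proof.
elim: s N => [|i s ih] [|N]; rewrite ?[wsum_lt 0 _]big_ord0 //.
  (* For the empty word the families differ only by word reversal, which preserves every length. *)
  rewrite le_eqVlt; apply/orP; left; apply/eqP; apply: eq_bigr => j _.
  rewrite -[RHS]wsum_eq_rev; apply: eq_wsum_eq => w _.
  by rewrite /Stheta take0 drop0 eqxx.
rewrite wsum_ltS_cons /Stheta /= (nrm2_0 ip_lin) add0r.
rewrite (bigD1 i) //= big1 ?addr0 => [|j /negPf ji].
  under eq_wsum_lt do rewrite eqseq_cons eqxx /=.
  apply: le_trans (ih N) _; apply: wsum_lt_homo (leqnSn N) => w.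
  exact: nrm2_ge0.
rewrite [LHS]big1 // => l _; apply: big1 => t _.
by rewrite eqseq_cons ji (nrm2_0 ip_lin).
Qed.

Lemma l2_Stheta s h : l2 ip (Stheta theta s h).
Proof.
have [_ [c hc]] := theta_bounded.
by exists (c * nrm2 ip h) => N; apply: le_trans (Stheta_partial_sum s h N) (hc h N).
Qed.

(** The linear relation to which the results on infima are applied: its fibre over [h] consists of
    the vectors whose energies compete in [DeltaQ]. *)
Definition shift_span (h : E) (u : seq 'I_n -> E) : Prop :=
  exists N (hs : seq 'I_n -> E), [/\ hs [::] = h, (forall w, (N <= size w)%N -> hs w = 0) &
    u = wsum_lt N (fun s => Stheta theta s (hs s))].

Lemma shift_span_lin (a : R[i]) x y u v : shift_span x u -> shift_span y v ->
  shift_span (a *: x + y) (a *: u + v).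
Proof.
move=> [N [hs [<- hs0 ->]]] [M [ks [<- ks0 ->]]].
exists (maxn N M), (fun w => a *: hs w + ks w); split=> // [w|].
  by rewrite geq_max => /andP[? ?]; rewrite hs0 // ks0 // scaler0 addr0.
have S0 (z : seq 'I_n -> E) w : z w = 0 -> Stheta theta w (z w) = 0.
  by move=> ->; apply/funext => g; rewrite Stheta0.
(* Both sums are padded with zero terms up to the common bound [maxn N M]. *)
rewrite -(wsum_lt_pad (leq_maxl N M)) => [|w Nw]; last by rewrite S0 // hs0.
rewrite -(wsum_lt_pad (leq_maxr N M)) => [|w Mw]; last by rewrite S0 // ks0.
rewrite (wsum_lt_morph (g := fun u : seq 'I_n -> E => a *: u)) ?scaler0 //; last exact: scalerDr.
rewrite -wsum_ltD; apply: eq_wsum_lt => w _; apply/funext => g.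
by rewrite Stheta_lin.
Qed.

Lemma shift_span_ex h : exists u, shift_span h u.
Proof.
exists (wsum_lt 1 (fun s => Stheta theta s (if s is [::] then h else 0))), 1%N.
by exists (fun s => if s is [::] then h else 0); split => // -[].
Qed.

Lemma l2_shift_span h u : shift_span h u -> l2 ip u.
Proof. by move=> [N [hs [_ _ ->]]]; apply: l2_wsum => // s; exact: l2_Stheta. Qed.

(** [Ktheta] is the [l2form] of two shifted copies of [theta], so the double sum is the Gram
    expansion of the squared norm of [u]. *)
Lemma Ktheta_energy N (hs : seq 'I_n -> E) :
  let u := wsum_lt N (fun s => Stheta theta s (hs s)) in
  wsum_lt N (fun s => wsum_lt N (fun w => Ktheta ip theta w s (hs s) (hs w))) =
  l2form ip u u.
Proof.
move=> u; have lS s : l2 ip (Stheta theta s (hs s)) by exact: l2_Stheta.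
have lu : l2 ip u by exact: l2_wsum.
rewrite [RHS]l2form_wsum //; apply: eq_wsum_lt => s _.
rewrite (l2form_conj ip_lin ip_conj ip_ge0 lu (lS s)) l2form_wsum //.
rewrite (wsum_lt_morph (g := @conjc R)) ?rmorph0 //; last exact: rmorphD.
by apply: eq_wsum_lt => w _; rewrite -l2form_conj.
Qed.

Lemma DeltaQE : DeltaQ ip theta = qinf shift_span (l2form ip (n := n)).
Proof.
apply/funext => h; congr inf; apply/seteqP; split => t /=.
  move=> [N [hs [h0 hsN ->]]]; exists (wsum_lt N (fun s => Stheta theta s (hs s))).
  by split; [exists N, hs|rewrite Ktheta_energy].
move=> [u [[N [hs [h0 hsN ->]]] ->]].
by exists N, hs; split => //; rewrite Ktheta_energy.
Qed.

Variable k : nat.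
Hypothesis theta_low : forall alpha h, (size alpha < k)%N -> theta alpha h = 0.

(* For [|g| = k] every term [s <> g_0] of the sum involves a coefficient of
   [theta] of index length [< k]. *)
Lemma shift_span_coeff h u g : shift_span h u -> size g = k -> u g = theta (rev g) h.
Proof.
(* Bound 0 forces [hs [::] = 0], so both sides vanish. *)
move=> [[|N] [hs [<- hsN ->]]] gk; first by rewrite hsN // theta0 /wsum_lt big_ord0.
rewrite wsum_ltE wsum_ltS_cons [X in _ + X]big1 ?addr0 => [|i _].
  by rewrite /Stheta take0 drop0 eqxx.
rewrite [LHS]big1 // => j _; apply: big1 => t _; rewrite /Stheta.
case: eqP => // tg; apply: theta_low; rewrite size_rev size_drop gk.
have : (size (take (size (i :: val t)) g) <= k)%N by rewrite -gk size_take_min geq_minr.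
by rewrite tg /= => ik; rewrite ltn_subrL; exact: leq_ltn_trans ik.
Qed.

Definition lead_form (x y : E) : R[i] :=
  wsum_eq k (fun alpha => ip (theta alpha x) (theta alpha y)).

Lemma lead_form_nrm2 x :
  complex.Re (lead_form x x) = wsum_eq k (fun alpha => nrm2 ip (theta alpha x)).
Proof. by apply: wsum_eq_morph => //; exact: RecD. Qed.

Lemma lead_form_lin (a : R[i]) x y z :
  lead_form (a *: x + y) z = a * lead_form x z + lead_form y z.
Proof.
rewrite /lead_form (wsum_eq_morph (g := *%R a)) ?mulr0 //; last exact: mulrDr.
by rewrite -wsum_eqD; apply: eq_wsum_eq => w _; rewrite theta_lin ip_lin.
Qed.

Lemma lead_form_conj x y : lead_form y x = conjc (lead_form x y).
Proof.
rewrite /lead_form (wsum_eq_morph (g := @conjc R)) ?rmorph0 //; last exact: rmorphD.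
by apply: eq_wsum_eq => w _; rewrite ip_conj.
Qed.

Lemma lead_form_expand (I : finType) (z : I -> R[i]) (x : I -> E) :
  lead_form (\sum_i z i *: x i) (\sum_i z i *: x i) =
  \sum_j \sum_i z j * conjc (z i) * lead_form (x j) (x i).
Proof.
(* The graph of the identity turns the expansion along a relation into one for a form on [E]. *)
apply: (L_expand (A := fun y y' => y' = y)) => //.
- by move=> a y y' _ _ -> ->.
- by move=> y; exists y.
- by move=> *; exact: lead_form_lin.
- by move=> *; exact: lead_form_conj.
Qed.

Lemma lead_form_le x u : shift_span x u ->
  complex.Re (lead_form x x) <= complex.Re (l2form ip u u).
Proof.
move=> xu; apply: le_trans (l2form_ge ip_lin ip_conj ip_ge0 k (l2_shift_span xu)).
rewrite lead_form_nrm2 -wsum_eq_rev le_eqVlt; apply/orP; left; apply/eqP.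
by apply: eq_wsum_eq => g gk; rewrite (shift_span_coeff xu gk).
Qed.

Let form_lin (a : R[i]) x y z u v f :
  shift_span x u -> shift_span y v -> shift_span z f ->
  l2form ip (a *: u + v) f = a * l2form ip u f + l2form ip v f.
Proof. by move=> xu yv zf; apply: l2form_lin => //; apply: l2_shift_span; eassumption. Qed.

Let form_conj x y u v : shift_span x u -> shift_span y v ->
  l2form ip v u = conjc (l2form ip u v).
Proof. by move=> xu yv; apply: l2form_conj => //; apply: l2_shift_span; eassumption. Qed.

Let form_ge0 x u : shift_span x u -> 0 <= complex.Re (l2form ip u u).
Proof. by move=> xu; apply: l2form_ge0 => //; apply: l2_shift_span; eassumption. Qed.

Lemma DeltaQ_ge h :
  wsum_eq k (fun alpha => nrm2 ip (theta alpha h)) <= DeltaQ ip theta h.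
Proof.
rewrite DeltaQE -lead_form_nrm2.
by apply: (qinf_ge shift_span_ex form_ge0) => u; exact: lead_form_le.
Qed.

(** [leadMx] and [DeltaMx] are the Gram matrices in [b] of [lead_form] and of the polarised infimum,
    and the latter form dominates the former. *)
Lemma det_DeltaMx_ge (m : nat) (b : 'I_m -> E) :
  complex.Re (\det (leadMx ip theta k b)) <= complex.Re (\det (DeltaMx ip theta b)).
Proof.
have := @det_form_le R E m lead_form (fun x y => (4%:R)^-1 * \sum_(l < 4)
  'i ^+ l * (DeltaQ ip theta (x + 'i ^+ l *: y))%:C) b.
apply => [| x y|z|z].
- exact: lead_form_conj.
- rewrite DeltaQE.
  exact: (qinf_form_conj shift_span_lin shift_span_ex form_lin form_conj form_ge0).
- rewrite -lead_form_expand lead_form_nrm2; apply: wsum_eq_ge0 => w; exact: nrm2_ge0.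
- rewrite -lead_form_expand DeltaQE.
  exact: (qinf_form_ge shift_span_lin shift_span_ex form_lin form_conj form_ge0 lead_form_le).
Qed.

Lemma entropy_ge (m : nat) (b : 'I_m -> E) :
  (lnE (complex.Re (\det (leadMx ip theta k b))) <= entropy ip theta b)%E.
Proof. exact/lnE_le/det_DeltaMx_ge. Qed.

End Symbol.

(** * The scalar case *)

Section Scalar.
Variables (R : realType) (n : nat) (c : seq 'I_n -> R[i]).
Let ip (x y : (R[i])^o) : R[i] := x * Num.conj y.
Let theta (alpha : seq 'I_n) (h : (R[i])^o) : (R[i])^o := c (rev alpha) * h.
Let b (_ : 'I_1) : (R[i])^o := 1.
Hypothesis c_l2 : exists C0 : R,
  forall N, wsum_lt N (fun w => complex.Re (`|c w| ^+ 2)) <= C0.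

Let ip_lin (a : R[i]) (x y z : (R[i])^o) : ip (a *: x + y) z = a * ip x z + ip y z.
Proof. by rewrite /ip mulrDl mulrA. Qed.

Let ip_conj (x y : (R[i])^o) : ip y x = conjc (ip x y).
Proof. by rewrite /ip rmorphM /= conjcK mulrC. Qed.

Let ip_ge0 (x : (R[i])^o) : 0 <= ip x x.
Proof. exact: mulcJ_ge0. Qed.

Let nrm2_theta alpha h :
  nrm2 ip (theta alpha h) = complex.Re (`|c (rev alpha)| ^+ 2) * nrm2 ip h.
Proof.
rewrite /nrm2 /ip /theta sqr_normc rmorphM /=.
by case: (c _) h => [p q] [r s] /=; ring.
Qed.

Let theta_bounded : symbol_bounded ip theta.
Proof.
split=> [alpha a x y|]; first by rewrite /theta mulrDr !scalerAr.
have [C0 hC] := c_l2; exists C0 => h N.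
apply: le_trans (ler_wpM2r (nrm2_ge0 ip_ge0 h) (hC N)).
rewrite le_eqVlt; apply/orP; left; apply/eqP.
rewrite [RHS](wsum_lt_morph (g := *%R^~ _)); last first.
- by move=> x y /=; rewrite mulrDl.
- exact: mul0r.
apply: eq_bigr => j _; rewrite -[RHS]wsum_eq_rev.
by apply: eq_wsum_eq => w _; rewrite nrm2_theta.
Qed.

Let re_sqr_ge0 w : 0 <= complex.Re (`|c w| ^+ 2).
Proof. by rewrite sqr_normc; case: (c w) => p q /=; nra. Qed.

(** For the least length [k] of a word with nonzero coefficient, the 1 by 1 leading determinant is
    the sum of [|c_v|^2] over words [v] of length [k], hence positive. *)
Lemma scalar_entropy_ge : (exists w, c w <> 0) ->
  (entropy ip theta b > -oo)%E /\
  (entropy ip theta b >= lnE (complex.Re (`|c [::]| ^+ 2)%R))%E.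
Proof.
move=> [w0 cw0].
have ex : exists k, `[< exists w, size w = k /\ c w <> 0 >].
  by exists (size w0); apply/asboolP; exists w0.
case: (ex_minnP ex) => k /asboolP[w [wk cw]] kmin.
have low alpha h : (size alpha < k)%N -> theta alpha h = 0.
  move=> ak; rewrite /theta; have [->|/eqP ca] := eqVneq (c (rev alpha)) 0.
    by rewrite mul0r.
  have /kmin : `[< exists v, size v = size alpha /\ c v <> 0 >].
    by apply/asboolP; exists (rev alpha); rewrite size_rev.
  by rewrite leqNgt ak.
have ge := entropy_ge ip_lin ip_conj ip_ge0 theta_bounded low b.
have leadE : complex.Re (\det (leadMx ip theta k b)) =
    wsum_eq k (fun v => complex.Re (`|c v| ^+ 2)).
  rewrite det_mx11 mxE -[RHS]wsum_eq_rev.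
  rewrite (wsum_eq_morph (g := @complex.Re R)) //; last exact: RecD.
  apply: eq_wsum_eq => v _; rewrite -[LHS]/(nrm2 ip (theta v 1)) nrm2_theta.
  by rewrite /nrm2 /ip rmorph1 mulr1 /= mulr1.
have c_le v : size v = k ->
    complex.Re (`|c v| ^+ 2) <= complex.Re (\det (leadMx ip theta k b)).
  by move=> vk; rewrite leadE -vk; apply: le_wsum_eq.
have cw_gt0 : 0 < complex.Re (`|c w| ^+ 2).
  move: cw; rewrite sqr_normc; case: (c w) => p q /= pq.
  have : (p != 0) || (q != 0).
    by apply: contra_notT pq; rewrite negb_or !negbK => /andP[/eqP -> /eqP ->].
  by rewrite -!expr2 mulrN opprK -!expr2 => /orP[] h;
    [rewrite ltr_pwDl|rewrite ltr_pwDr] => //; rewrite ?sqr_ge0 // exprn_even_gt0.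
split; first apply: lt_le_trans ge.
  have := lt_le_trans cw_gt0 (c_le w wk).
  by rewrite /lnE ltNge => /negPf ->; exact: ltNyr.
(* If [c [::] = 0] the lower bound is [-oo]; otherwise minimality gives [k = 0] and the bound is the
   leading term. *)
have [c0|/eqP c0] := eqVneq (c [::]) 0.
  by rewrite c0 normr0 expr0n /= /lnE lexx leNye.
have k0 : k = 0%N.
  have /kmin : `[< exists v : seq 'I_n, size v = 0%N /\ c v <> 0 >].
    by apply/asboolP; exists [::].
  by rewrite leqn0 => /eqP.
by apply: le_trans ge; apply/lnE_le/c_le; rewrite k0.
Qed.

End Scalar.

Theorem mainTheorem8 (R : realType) (n : nat) :
  (* main statement: E Hilbert space, theta nonzero in B(E, F^2(H_n) (x) E) *)
  (forall (E : lmodType R[i]) (ip : E -> E -> R[i])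
          (theta : seq 'I_n -> E -> E) (k : nat),
     hilbert_space ip ->
     symbol_bounded ip theta ->
     (exists alpha h, theta alpha h <> 0) ->
     (* k = least length of a word alpha_0 with theta_{alpha_0} <> 0 *)
     (exists alpha0 h, size alpha0 = k /\ theta alpha0 h <> 0) ->
     (forall alpha h, (size alpha < k)%N -> theta alpha h = 0) ->
     (* (i) dim E < oo *)
     (forall (m : nat) (b : 'I_m -> E), onb ip b ->
        [/\ exists h, DeltaQ ip theta h <> 0,
            (forall h, DeltaQ ip theta h >=
                         wsum_eq k (fun alpha => nrm2 ip (theta alpha h))) &
            (entropy ip theta b >=
               lnE (complex.Re (\det (leadMx ip theta k b))))%E])
     /\
     (* (ii) E arbitrary, theta the symbol of a nonzero multi-analytic M *)
     (forall M : (seq 'I_n -> E) -> (seq 'I_n -> E),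
        multi_analytic ip M ->
        (exists f, l2 ip f /\ M f <> (fun _ => 0)) ->
        is_symbol M theta ->
        (forall h, DeltaQ ip theta h >=
                     wsum_eq k (fun alpha => nrm2 ip (theta alpha h))) /\
        (forall (m : nat) (b : 'I_m -> E), onb ip b ->
           (entropy ip theta b >=
              lnE (complex.Re (\det (leadMx ip theta k b))))%E)))
  /\
  (* particular case E = C, theta = sum_beta c_beta e_beta in F^2(H_n) nonzero;
     then theta_alpha h = c_{rev alpha} h and theta(0) = c_{g_0} *)
  (forall c : seq 'I_n -> R[i],
     (exists C0 : R, forall N, wsum_lt N (fun w => complex.Re (`|c w| ^+ 2)) <= C0) ->
     (exists w, c w <> 0) ->
     let ip := fun x y : (R[i])^o => x * y^* in
     let theta := fun (alpha : seq 'I_n) (h : (R[i])^o) => (c (rev alpha) * h : (R[i])^o) in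
     let b := fun _ : 'I_1 => (1 : (R[i])^o) in
     (entropy ip theta b > -oo)%E /\
     (entropy ip theta b >= lnE (complex.Re (`|c [::]| ^+ 2)%R))%E).
Proof.
split=> [E ip theta k [ip_lin ip_conj ip_ge0 ip_def _] thb _ [alpha0 [h0 [a0k th0]]] low|];
  last by move=> c c_l2 c0; exact: scalar_entropy_ge.
have lb := DeltaQ_ge ip_lin ip_conj ip_ge0 thb low.
have ent := entropy_ge ip_lin ip_conj ip_ge0 thb low.
split=> [m b _|M _ _ _]; last by split=> // m b _; exact: ent.
(* [DeltaQ] at [h0] is at least the squared norm of [theta alpha0 h0]; were it 0, definiteness of
   [ip] would make this vector vanish. *)
split=> //; exists h0 => D0.
have nrm_ge0 w : 0 <= nrm2 ip (theta w h0) by exact: nrm2_ge0.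
have := le_trans (le_wsum_eq alpha0 nrm_ge0) _; rewrite a0k => /(_ _ (lb h0)).
rewrite D0 => th_le0; apply: th0; apply: ip_def.
rewrite (ip_nrm2 ip_conj); congr (_%:C).
by apply/le_anti; rewrite th_le0 nrm_ge0.
Qed.
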